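(* Suppose that a finite group $G$ is a semidirect product of an abelian group $A$ (the normal subgroup) and a generalized quaternion group $Q$ (the complement), and that each element of $Q$ acts on $A$ by raising each element to some fixed power (i.e. for each $q\in Q$ there is an integer $k$ such that $a^{q}=a^{k}$ for all $a\in A$). Suppose further that a Sylow $2$-subgroup of $G$ has an abelian subgroup of index $2$. Then $\mathrm{Out}_{\mathrm{c}}(G)=1$, i.e. every class-preserving automorphism of $G$ is an inner automorphism.
   Context: An automorphism $\sigma$ of a group $G$ is class-preserving if for every $g\in G$ the image of $g$ under $\sigma$ is conjugate to $g$ in $G$. $\mathrm{Aut}_{\mathrm{c}}(G)$ denotes the group of class-preserving automorphisms of $G$ and $\mathrm{Out}_{\mathrm{c}}(G)=\mathrm{Aut}_{\mathrm{c}}(G)/\mathrm{Inn}(G)$. Generalized quaternion groups are the groups $\langle x,y \mid x^{2^{n-1}}=1,\ y^{2}=x^{2^{n-2}},\ y^{-1}xy=x^{-1}\rangle$ of order $2^{n}$, $n\geq 3$ (including the quaternion group of order $8$). Here $a^{q}=q^{-1}aq$. *)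

(* Defs.v *)
From mathcomp Require Import all_boot all_algebra all_fingroup all_solvable.

Set Implicit Arguments.
Unset Strict Implicit.
Unset Printing Implicit Defensive.

Import GroupScope.

(* Group analogue of exprz: the library's x ^+ n only has n : nat. *)
Definition expgz (gT : finGroupType) (x : gT) (k : int) : gT :=
  match k with
  | Posz n => x ^+ n
  | Negz n => x ^- n.+1
  end.

Definition Autc (gT : finGroupType) (G : {set gT}) : {set {perm gT}} :=
  [set s in Aut G | [forall g in G, s g \in g ^: G]].

Definition Inn (gT : finGroupType) (G : {group gT}) : {set {perm gT}} :=
  conj_aut G @* G.

(* The quotient A / H is only meaningful when A normalises H: see Inn_normal. *)
Definition Outc (gT : finGroupType) (G : {group gT}) :
    {set coset_of (Inn G)} :=
  Autc G / Inn G.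

Lemma Autc_group_set (gT : finGroupType) (G : {group gT}) :
  group_set (Autc G).
Proof.
apply/group_setP; split=> [|s t].
  apply/setIdP; split; first exact: group1.
  by apply/forall_inP=> g _; rewrite perm1 class_refl.
case/setIdP=> As /forall_inP cs /setIdP[At /forall_inP ct].
apply/setIdP; split; first exact: groupM.
apply/forall_inP=> g Gg; rewrite permM.
have Gsg : s g \in G by rewrite Aut_closed.
have /class_eqP <- := cs g Gg.
exact: ct.
Qed.

Canonical Autc_group (gT : finGroupType) (G : {group gT}) :=
  Group (Autc_group_set G).

Canonical Inn_group (gT : finGroupType) (G : {group gT}) :=
  Eval hnf in [group of Inn G].

Lemma Inn_normal (gT : finGroupType) (G : {group gT}) : Inn G <| Autc G.
Proof.
apply/andP; split.
  apply/subsetP=> _ /morphimP[x _ Gx ->].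
  apply/setIdP; split; first exact: Aut_aut.
  apply/forall_inP=> g Gg.
  by rewrite conj_autE // memJ_class.
apply/subsetP=> s /setIdP[As _]; rewrite inE.
apply/subsetP=> _ /imsetP[_ /morphimP[x Nx Gx ->] ->].
have Gsx : s x \in G by rewrite Aut_closed.
suff -> : conj_aut G x ^ s = conj_aut G (s x).
  by rewrite mem_morphim // (subsetP (normG G)).
apply: (eq_Aut (A := G)); rewrite ?Aut_aut //.
  by rewrite groupJ // Aut_aut.
move=> g Gg; rewrite conj_autE // conjgE !permM.
have AsV : s^-1 \in Aut G by rewrite groupV.
have Gsg : s^-1 g \in G by rewrite Aut_closed.
rewrite conj_autE //.
have sM : {in G &, {morph s : u v / u ^ v}}.
  by move=> u v Gu Gv; rewrite -!(autmE As) morphJ.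
by rewrite sM // permKV.
Qed.

Lemma Outc_eq1 (gT : finGroupType) (G : {group gT}) :
  Outc G = 1 <->
  (forall s, s \in Autc G -> exists2 x, x \in G & {in G, forall g, s g = g ^ x}).
Proof.
have /andP[_ nIA] := Inn_normal G; split=> [/eqP | allI].
  rewrite -subG1 quotient_sub1 // => sAI s Ac.
  have /morphimP[x _ Gx ->] := subsetP sAI s Ac.
  by exists x => // g Gg; rewrite conj_autE.
apply/eqP; rewrite -subG1 quotient_sub1 //; apply/subsetP=> s Ac.
have [x Gx sE] := allI s Ac; have /setIdP[As _] := Ac.
have -> : s = conj_aut G x.
  apply: (eq_Aut As); rewrite ?Aut_aut // => g Gg.
  by rewrite conj_autE // sE.
by rewrite mem_morphim // (subsetP (normG G)).
Qed.

(* Main.v *)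
(* By powers, Q acts on A through an elementary abelian group, and the Sylow
   hypothesis gives a cyclic subgroup <x> of index 2 in Q centralising O_2(A).
   Pick y in Q outside <x>. Since x inverts every [a, x], and [a, x] has odd
   order, [a, x]^2 = 1 forces [a, x] = 1.
   After an inner adjustment, a class-preserving f satisfies f x = x and
   f y = y^b with b in A, while f restricted to A is conjugation by some r in Q.
   Comparing f (u a) with u a for u = x, y, xy shows that [a, r] has the form
   [d, u], which u inverts; as x, y and xy all invert [a, r], its square is
   trivial, hence so is [a, r]. So f fixes A pointwise, and splitting b into an
   x-fixed part and a commutator with x shows that f is conjugation by the
   x-fixed part. *)
Require Import Defs.
From mathcomp Require Import all_boot all_algebra all_fingroup all_solvable.

Import GroupScope.

(** * Power maps on a finite abelian group *)

Lemma expgzJ (gT : finGroupType) (a g : gT) (k : int) :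
  expgz a k ^ g = expgz (a ^ g) k.
Proof. by case: k => n; rewrite /= ?conjVg conjXg. Qed.

Lemma expgz_cycle (gT : finGroupType) (a : gT) (k : int) : expgz a k \in <[a]>.
Proof. by case: k => n; rewrite /= ?groupV mem_cycle. Qed.

Lemma in_morphX (gT : finGroupType) (G : {group gT}) (f : gT -> gT) :
    {in G &, {morph f : g h / g * h}} ->
  forall g n, g \in G -> f (g ^+ n) = f g ^+ n.
Proof.
move=> fM g n Gg; have f1 : f 1 = 1.
  by apply: (mulgI (f 1)); rewrite -fM ?mulg1.
by elim: n => // n IH; rewrite !expgS fM ?groupX // IH.
Qed.

(** The witness [a0] has order the exponent of [A], so [<[a0]>] has a complement [D] in [A]. The
    exponent by which a map acts on [a0], taken modulo this order, then determines its action on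
    each [d] in [D]. *)
Lemma eq_power_morphism (gT : finGroupType) (A : {group gT}) :
    abelian A ->
  exists2 a0, a0 \in A &
    forall f g : gT -> gT,
      {in A &, {morph f : a b / a * b}} -> {in A &, {morph g : a b / a * b}} ->
      {in A, forall a, f a \in <[a]>} -> {in A, forall a, g a \in <[a]>} ->
    f a0 = g a0 -> {in A, f =1 g}.
Proof.
move=> abelA; have [a0 Aa0 oa0] := exponent_witness (abelian_nil abelA).
exists a0 => // f g fM gM fc gc fg0.
case/splitsP: (abelian_splits Aa0 (esym oa0) abelA) => D /complP[tiD defA].
have sDA : D \subset A by rewrite -defA mulG_subr.
have split_power (h : gT -> gT) d : {in A &, {morph h : a b / a * b}} ->
    {in A, forall a, h a \in <[a]>} -> d \in D ->
  exists2 n, h a0 = a0 ^+ n & h d = d ^+ n.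
  (* The exponent [n] is read off at [a0 * d]; as [<[a0]>] meets [D] trivially, it serves for both
     factors. *)
  move=> hM hc Dd; have Ad := subsetP sDA d Dd.
  have /cycleP[n hn] := hc _ (groupM Aa0 Ad).
  have hd : (h a0)^-1 * a0 ^+ n = h d * (d ^+ n)^-1.
    apply: (canRL (mulgK _)); rewrite -mulgA; apply: (canLR (mulKg _)).
    by rewrite -hM // hn expgMn //; apply: (centsP abelA).
  have : h d * (d ^+ n)^-1 \in <[a0]> :&: D.
    have sdD : <[d]> \subset D by rewrite cycle_subG.
    rewrite inE -{1}hd !groupM ?groupV ?mem_cycle ?groupX ?hc //=.
    exact: (subsetP sdD _ (hc d Ad)).
  rewrite tiD => /set1gP hd1; exists n; apply/eqP.
    by rewrite eq_mulVg1 hd hd1.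
  by rewrite eq_mulgV1 hd1.
have fgD d : d \in D -> f d = g d.
  move=> Dd; have [n fn ->] := split_power f d fM fc Dd.
  have [m gm ->] := split_power g d gM gc Dd.
  move/eqP: fg0; rewrite fn gm eq_expg_mod_order -oa0 => /eqP e_nm.
  apply/eqP; rewrite eq_expg_mod_order; apply/eqP.
  have/modn_dvdm dv := dvdn_exponent (subsetP sDA d Dd).
  by rewrite -(dv n) e_nm dv.
have fgX i : f (a0 ^+ i) = g (a0 ^+ i).
  by rewrite !(in_morphX _ A) ?fg0.
move=> a; rewrite -{1}defA => /mulsgP[_ d /cycleP[i ->] Dd ->].
by rewrite fM ?gM ?groupX ?(subsetP sDA d) // fgX fgD.
Qed.

(** * Generalized quaternion groups *)

Lemma quaternion_invariants (gT : finGroupType) (Q : {group gT}) (n : nat) :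
    2 < n -> Q \isog 'Q_(2 ^ n) ->
  [/\ 2.-group Q, ~~ abelian Q, #|'Ohm_1(Q)| = 2, 'Z(Q) \subset Q^`(1)
    & forall u, u \in Q -> u ^+ 2 \in Q^`(1)].
Proof.
move=> n_gt2 isoQ; have [[x y] genQ _] := generators_quaternion n_gt2 isoQ.
have [_ [defQ' defPhi oQ' _] [defZ oZ _ [defO _] _] _ _] :=
  quaternion_structure n_gt2 genQ isoQ.
have pQ : 2.-group Q by rewrite /pgroup (card_isog isoQ) card_quaternion // pnatX.
split=> //.
- apply/negP => /derG1P Q'1; move/(congr1 odd): oQ'.
  by rewrite Q'1 cards1 -[n](subnK n_gt2) addn3 /= expnS oddM.
- by rewrite defO -defZ.
- rewrite defZ defQ' -[n](subnK n_gt2) addn3 /= expnS expgM.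
  exact: cycleX.
move=> u Qu; rewrite -defPhi (Phi_joing pQ) mem_gen // inE orbC.
by rewrite (Mho_p_elt 1) ?(mem_p_elt pQ).
Qed.

(** As ['Ohm_1(Q)] has order 2, the 2-group [C] has rank at most 1. *)
Lemma abelian_sub_quaternion_cyclic (gT : finGroupType) (Q C : {group gT}) (n : nat) :
  2 < n -> Q \isog 'Q_(2 ^ n) -> C \subset Q -> abelian C -> cyclic C.
Proof.
move=> n_gt2 isoQ sCQ abelC.
have [pQ _ oO _ _] := quaternion_invariants _ _ _ n_gt2 isoQ.
have pC := pgroupS sCQ pQ.
rewrite abelian_rank1_cyclic // (rank_pgroup pC) p_rank_abelian //.
have leCQ := dvdn_leq_log 2 (cardG_gt0 'Ohm_1(Q)) (cardSg (OhmS 1 sCQ)).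
by rewrite (leq_trans leCQ) ?oO.
Qed.

(** * Action of the complement on [A] by power maps *)

Section ClassPreserving.

Variables (gT : finGroupType) (G A Q : {group gT}).
Hypotheses (sdG : A ><| Q = G) (abelA : abelian A).
Hypothesis powA : forall q : gT, q \in Q ->
  exists k : int, forall a : gT, a \in A -> a ^ q = expgz a k.

Lemma memJ_compl a q : a \in A -> q \in Q -> a ^ q \in A.
Proof.
by have [_ _ nAQ _] := sdprodP sdG => Aa Qq; rewrite memJ_norm ?(subsetP nAQ).
Qed.

Lemma compl_actC a p q : a \in A -> p \in Q -> q \in Q -> (a ^ p) ^ q = (a ^ q) ^ p.
Proof.
move=> Aa Qp Qq; have [k kP] := powA p Qp.
by rewrite (kP a) // expgzJ kP // memJ_compl.
Qed.

(** Power maps commute with every conjugation ([compl_actC]), so commutators of [Q] act trivially on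
    [A]. *)
Lemma der1_compl_cent : Q^`(1) \subset 'C(A).
Proof.
rewrite gen_subG; apply/subsetP=> _ /imset2P[p q Qp Qq ->].
apply/centP=> a Aa; apply/esym/commgP/conjg_fixP.
rewrite commgEl conjgM conjgE !conjgM.
by rewrite (compl_actC _ q^-1) ?memJ_compl ?groupV // conjgKV conjgKV.
Qed.

Lemma compl_commMg a b u :
  a \in A -> b \in A -> u \in Q -> [~ a * b, u] = [~ a, u] * [~ b, u].
Proof.
move=> Aa Ab Qu; rewrite commMgJ; congr (_ * _); apply/conjg_fixP/commgP.
by apply: (centsP abelA); rewrite // commgEl groupM ?groupV ?memJ_compl.
Qed.

Lemma compl_mem_comm a u : a \in A -> u \in Q -> [~ a, u] \in A.
Proof. by move=> Aa Qu; rewrite commgEl groupM ?groupV ?memJ_compl. Qed.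

Lemma compl_commVg a u : a \in A -> u \in Q -> [~ a^-1, u] = [~ a, u]^-1.
Proof.
move=> Aa Qu; apply/eqP; rewrite eq_sym eq_invg_mul -compl_commMg ?groupV //.
by rewrite mulgV comm1g.
Qed.

Hypothesis squaresQ : forall u, u \in Q -> u ^+ 2 \in Q^`(1).

(** The square of [u] centralises [A], so conjugation by [u] swaps [a] and [a ^ u]. *)
Lemma compl_comm_inv a u : a \in A -> u \in Q -> [~ a, u] ^ u = [~ a, u]^-1.
Proof.
move=> Aa Qu; have cu2 : (a ^ u) ^ u = a.
    rewrite -conjgM.
  apply/conjg_fixP/commgP/commute_sym/(centP _ _ Aa).
  exact: (subsetP der1_compl_cent _ (squaresQ _ Qu)).
by rewrite commgEl conjMg cu2 conjVg [RHS]invMg invgK.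
Qed.

(* Modulo A, the elements conjugating u a to f (u a) lie in C_Q(u), so they move
   a only by an element of [A, u]. *)
Lemma class_preserving_comm (f : gT -> gT) r u c :
    {in G &, {morph f : g h / g * h}} -> {in G, forall g, f g \in g ^: G} ->
    r \in Q -> {in A, forall a, f a = a ^ r} ->
    u \in Q -> c \in A -> f u = u * c ->
    (forall w, w \in Q -> commute w u ->
       forall a, a \in A -> a ^ w = a \/ a ^ w = a ^ u) ->
  forall a, a \in A -> exists2 b, b \in A & [~ a, r] = [~ b, u].
Proof.
move=> fM fcl Qr fA Qu Ac fu centu.
have [/andP[sAG _] sQG defG nAQ tiAQ] := sdprod_context sdG.
have cA := centsP abelA.
have step a : a \in A -> exists2 b, b \in A & c * a ^ r = [~ b, u] * a.
  move=> Aa; have Gu := subsetP sQG u Qu; have Ga := subsetP sAG a Aa.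
  have /imsetP[g Gg] := fcl _ (groupM Gu Ga).
  rewrite fM // fu fA //.
  (* With the conjugating element written [w * b], comparison modulo [A] gives [u ^ w = u], and the
     part in [A] leaves [c * a ^ r = [~ b^-1, u] * a ^ w]. *)
  move: Gg; rewrite -defG -(normC nAQ) => /mulsgP[w b Qw Ab ->] /esym.
  rewrite conjgM => /(canRL (conjgK b)).
  have Acr : c * a ^ r \in A by rewrite groupM ?memJ_compl.
  have cbcr : (c * a ^ r) ^ b^-1 = c * a ^ r.
    by apply/conjg_fixP/commgP/cA; rewrite ?groupV.
  rewrite -(mulgA u c) conjMg [in RHS]conjMg cbcr (conjg_mulR u b^-1) => eqw.
  have Aub : [~ u, b^-1] \in A.
    by rewrite -invg_comm groupV compl_mem_comm ?groupV.
  have defcr : u^-1 * u ^ w = [~ u, b^-1] * (c * a ^ r) * (a ^ w)^-1.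
    by rewrite (canRL (mulgK _) eqw) -!mulgA mulKg.
  have uw1 : u^-1 * u ^ w = 1.
    apply/set1gP; rewrite -tiAQ inE; apply/andP; split.
      by rewrite defcr groupMr ?groupV ?memJ_compl // groupM.
    by rewrite groupM ?groupV ?groupJ.
  have cwu : commute w u.
    by apply/commute_sym/commgP; rewrite commgEl uw1.
  move/eqP: defcr; rewrite uw1 eq_sym -eq_mulgV1 -invg_comm => /eqP.
  move/(canRL (mulKVg _)).
  have [] := centu w Qw cwu a Aa => ->.
    by exists b^-1; rewrite ?groupV.
  move->; exists (b^-1 * a); first by rewrite groupM ?groupV.
  rewrite compl_commMg ?groupV // -[RHS]mulgA.
  by rewrite (cA _ (compl_mem_comm _ _ Aa Qu) _ Aa) -conjg_mulR.
(* The case [a = 1] exhibits [c] itself as a commutator with [u], which is then divided out. *)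
move=> a Aa; have [b Ab eb] := step a Aa; have [b0 Ab0] := step 1 (group1 A).
rewrite conj1g !mulg1 => ec; exists (b0^-1 * b); first by rewrite groupM ?groupV.
rewrite compl_commMg ?groupV // compl_commVg // -ec.
have Abu := compl_mem_comm _ _ Ab Qu.
by rewrite commgEl (canRL (mulKg _) eb) (cA _ Abu _ Aa) (mulgA c^-1)
  (cA _ (groupVr Ac) _ Aa) -mulgA mulKg.
Qed.

(** * The cyclic subgroup [<[x]>] of index at most 2 in [Q] *)

Variables x y : gT.
Hypotheses (Qx : x \in Q) (Qy : y \in Q) (nXy : x ^ y \in <[x]>).
Hypothesis defQ : forall w, w \in Q -> w \in <[x]> \/ y^-1 * w \in <[x]>.
Hypothesis centerQ : 'Z(Q) \subset Q^`(1).
Hypothesis x_cent2 : forall a, a \in A -> 2.-elt a -> a ^ x = a.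

(** The 2-part of [a] is fixed by [x], so only the odd part contributes. *)
Lemma comm_x_odd a : a \in A -> 2^'.-elt [~ a, x].
Proof.
move=> Aa; have Aac pi : a.`_pi \in A by rewrite groupX.
rewrite -(consttC 2 a) compl_commMg // {1}/commg x_cent2 ?p_elt_constt // mulVg mul1g.
rewrite commgEl p_eltM ?p_eltV ?p_eltJ ?p_elt_constt //.
by apply: (centsP abelA); rewrite ?groupV ?memJ_compl.
Qed.

Lemma comm_x_sqr a : a \in A -> [~ a, x]^-1 = [~ a, x] -> [~ a, x] = 1.
Proof.
move=> Aa inv; apply/eqP; rewrite -order_eq1; apply/eqP/(@pnat_1 2).
  apply: (@pnat_dvd _ 2) => //.
  by rewrite order_dvdn expgS expg1 -{1}inv mulVg.
exact: comm_x_odd.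
Qed.

Lemma conj_der1_compl w a : w \in Q^`(1) -> a \in A -> a ^ w = a.
Proof.
move=> Q'w Aa; apply/conjg_fixP/commgP/commute_sym/(centP _ _ Aa).
exact: (subsetP der1_compl_cent).
Qed.

(** An element commuting with both [x] and [y] is central in [Q], hence acts trivially on [A]. Up to
    a factor [u] or an even power of [x], the element [w] is of this kind or trivial. *)
Lemma cent_conj_compl u w a :
    u = x \/ y^-1 * u \in <[x]> -> w \in Q -> commute w u -> a \in A ->
  a ^ w = a \/ a ^ w = a ^ u.
Proof.
move=> defu Qw cwu Aa.
have sXQ : <[x]> \subset Q by rewrite cycle_subG.
have cXX v w' : v \in <[x]> -> w' \in <[x]> -> commute v w'.
  by move=> Xv Xw; apply: (centsP (cycle_abelian x)).
have cXy v q : y^-1 * q \in <[x]> -> commute v q -> commute v (y^-1 * q) ->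
    commute v y.
  move=> Xq cvq cvyq; rewrite -[y](mulKVg q) -[q^-1 * y]invgK invMg invgK.
  exact/commuteM/commuteV.
have cXv v q : commute v x -> q \in <[x]> -> commute v q.
  by move=> cvx /cycleP[i ->]; apply: commuteX.
have central v b : v \in Q -> commute v x -> commute v y -> b \in A -> b ^ v = b.
  move=> Qv cvx cvy Ab; apply: conj_der1_compl => //; apply: (subsetP centerQ).
  rewrite inE Qv /=; apply/centP=> q Qq.
  have [Xq | Xq] := defQ q Qq; first exact: cXv.
  by rewrite -(mulKVg y q); apply: commuteM => //; apply: cXv.
case: defu cwu => [-> | Xu] cwu.
  have [/cycleP[i ->] | Xw] := defQ w Qw.
    (* Since [x ^+ 2] acts trivially, only the parity of [i] matters. *)
    rewrite -(odd_double_half i) addnC expgD -mul2n expgM conjgM.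
    rewrite (conj_der1_compl _ _ (groupX _ (squaresQ _ Qx)) Aa).
    by case: (odd i); rewrite ?expg0 ?conjg1; [right | left].
  by left; apply: central => //; apply: (cXy w w) => //; apply: cXv.
have {}cXy v : v \in <[x]> -> commute v u -> commute v y.
  by move=> Xv cvu; apply: (cXy v u) => //; apply: cXX.
have [Xw | Xw] := defQ w Qw.
  by left; apply: central => //; [apply: cXX; rewrite ?cycle_id | apply: cXy].
(* Both [w] and [u] lie in the coset of [y], so [u^-1 * w] is in [<[x]>] and commutes with [u]; it
   is therefore central. *)
right; have Xz : u^-1 * w \in <[x]>.
  by rewrite -(mulKVg y w) mulgA groupM // -groupV invMg invgK.
rewrite -{1}(mulKVg u w) conjgM.
apply: central; rewrite ?(subsetP sXQ) ?memJ_compl //.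
- by apply: cXX; rewrite ?cycle_id.
- apply: cXy => //; apply: commute_sym; apply: commuteM; last exact: commute_sym.
  exact/commuteV/commute_refl.
by rewrite -(mulKVg y u) groupM // (subsetP sXQ).
Qed.

(** * Class-preserving maps adjusted to fix [x] *)

Section Normalized.

Variable f : gT -> gT.
Hypothesis fM : {in G &, {morph f : g h / g * h}}.
Hypothesis f_class : {in G, forall g, f g \in g ^: G}.

(* x, y and x y all invert [~ a, r], so it is both fixed and inverted by x y. *)
Lemma normalized_trivial_on_normal r c :
    r \in Q -> {in A, forall a, f a = a ^ r} ->
    f x = x -> c \in A -> f y = y * c ->
  {in A, forall a, f a = a}.
Proof.
move=> Qr fA fx Ac fy a Aa; rewrite fA //.
have sQG : Q \subset G by have [] := sdprod_context sdG.
have step u d : u = x \/ y^-1 * u \in <[x]> -> u \in Q -> d \in A -> f u = u * d ->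
    [~ a, r] ^ u = [~ a, r]^-1.
  move=> defu Qu Ad fu.
  have [|b Ab ->] :=
    class_preserving_comm f r u d fM f_class Qr fA Qu Ad fu _ a Aa.
    by move=> w Qw cwu a' Aa'; apply: cent_conj_compl.
  exact: compl_comm_inv.
have ex : [~ a, r] ^ x = [~ a, r]^-1.
  by apply: (step x 1) => //; [left | rewrite mulg1].
have ey : [~ a, r] ^ y = [~ a, r]^-1.
  by apply: (step y c) => //; right; rewrite mulVg group1.
have exy : [~ a, r] ^ (x * y) = [~ a, r]^-1.
  apply: (step _ c) => //; first by right.
    by rewrite groupM.
  by rewrite fM ?(subsetP sQG) // fx fy mulgA.
apply/conjg_fixP.
(* Writing [[~ a, r]] as a commutator with [x] makes its order odd. *)
have [||b Ab eb] :=
  class_preserving_comm f r x 1 fM f_class Qr fA Qx (group1 A) _ _ a Aa.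
- by rewrite mulg1.
- by move=> w Qw cwx a' Aa'; apply: cent_conj_compl => //; left.
rewrite eb; apply/eqP/comm_x_sqr; rewrite // -eb -exy conjgM ex conjVg ey invgK //.
Qed.

Lemma compl_commJ a u v :
  a \in A -> u \in Q -> v \in Q -> [~ a, u] ^ v = [~ a ^ v, u].
Proof. by move=> Aa Qu Qv; rewrite !commgEl conjMg conjVg compl_actC. Qed.

(** It suffices to replace [b] by an element of [A] that commutes with [x] and has the same
    commutator with [y]. *)
Lemma normalized_inner b :
    {in A, forall a, f a = a} -> f x = x -> b \in A -> f y = y ^ b ->
  exists2 g, g \in G & {in G, forall h, f h = h ^ g}.
Proof.
move=> fA fx Ab fy; have [/andP[sAG _] sQG defG nAQ tiAQ] := sdprod_context sdG.
have cA := centsP abelA.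
have Gx := subsetP sQG x Qx; have Gy := subsetP sQG y Qy.
have fXx v : v \in <[x]> -> f v = v by case/cycleP=> i ->; rewrite (in_morphX _ G) ?fx.
have Aby : [~ b, y] \in A by apply: compl_mem_comm.
have fyE : f y = y * [~ b, y]^-1 by rewrite invg_comm -conjg_mulR.
have conj_xy c : c \in A -> c ^ (x ^ y) = c ^ x.
  move=> Ac; rewrite conjgE [x ^ y]conjgE -conjgE !conjgM.
  by rewrite (compl_actC c y^-1 x) ?groupV // conjgKV.
(* Applying [f] to [x * y = y * x ^ y] shows that [[~ b, y]] commutes with [x ^ y], which acts on
   [A] as [x] does. *)
have cx_by : [~ b, y] ^ x = [~ b, y].
  have Gxy : x ^ y \in G by rewrite groupJ.
  have : f (x * y) = f (y * x ^ y) by rewrite -conjgC.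
  rewrite (fM x y) // (fM y (x ^ y)) // fx (fXx (x ^ y)) // fyE.
  rewrite (mulgA x y) (conjgC x y) -!(mulgA y) => /mulgI cxy.
  rewrite -conj_xy //; apply/conjg_fixP/commgP.
  by rewrite -[X in commute X _]invgK; apply/commute_sym/commuteV.
(* s is a square root of the odd part of b, so b * [~ s, x] = b_2 * s * s ^ x,
   which x fixes. *)
pose s := b.`_2^' ^+ (uphalf #[b.`_2^']).
have As : s \in A by rewrite !groupX.
have s2 : s * s = b.`_2^'.
  rewrite -expgD addnn odd_uphalfK ?expgS ?expg_order ?mulg1 //.
  by rewrite odd_2'nat; apply: p_elt_constt.
have Asx : [~ s, x] \in A by apply: compl_mem_comm.
have Ab' : b * [~ s, x] \in A by rewrite groupM.
have b'x : (b * [~ s, x]) ^ x = b * [~ s, x].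
  have -> : b * [~ s, x] = b.`_2 * (s * s ^ x).
    by rewrite -{1}(consttC 2 b) -s2 commgEl -!mulgA mulKVg.
  rewrite conjMg (conjMg s) x_cent2 ?p_elt_constt ?groupX // -conjgM.
  rewrite (conj_der1_compl (x * x) s (squaresQ _ Qx) As).
  by rewrite (cA s As) // memJ_compl.
(* The error term [[~ [~ s, x], y]] is also a commutator with [x], so [x] inverts it. As a quotient
   of the [x]-fixed elements [[~ b * [~ s, x], y]] and [[~ b, y]], it is fixed by [x] too, hence
   trivial by [comm_x_sqr]. *)
have b'y : [~ b * [~ s, x], y] = [~ b, y].
  have defb' : [~ [~ s, x], y] = [~ [~ s, y], x].
    rewrite [LHS]commgEl compl_commJ // -compl_commVg // -compl_commMg ?groupV //.
    exact: memJ_compl.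
  rewrite compl_commMg //; suff -> : [~ [~ s, x], y] = 1 by rewrite mulg1.
  have Asy := compl_mem_comm _ _ As Qy.
  rewrite defb'; apply: comm_x_sqr => //; rewrite -compl_comm_inv // -defb'.
  have -> : [~ [~ s, x], y] = [~ b, y]^-1 * [~ b * [~ s, x], y].
    by rewrite compl_commMg // mulKg.
  by rewrite conjMg conjVg cx_by compl_commJ // b'x.
exists (b * [~ s, x]); first exact: (subsetP sAG).
set b' := b * _ in Ab' b'x b'y *.
have fXb v : v \in <[x]> -> f v = v ^ b'.
  move=> Xv; rewrite fXx //; case/cycleP: Xv => i ->.
  by apply/esym/conjg_fixP/commgP/commute_sym/commuteX/commgP/conjg_fixP.
have fyb : f y = y ^ b' by rewrite fyE conjg_mulR -(invg_comm b') b'y.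
have fQb q : q \in Q -> f q = q ^ b'.
  move=> Qq; have [/fXb // | Xq] := defQ q Qq.
  rewrite -(mulKVg y q) conjMg -fyb -fXb // fM //.
  by rewrite groupM ?groupV // (subsetP sQG).
move=> h; rewrite -defG => /mulsgP[a q Aa Qq ->].
rewrite fM ?(subsetP sAG a) ?(subsetP sQG q) // conjMg (fQb q) ?(fA a) //; congr (_ * _).
by apply/esym/conjg_fixP/commgP/cA.
Qed.

End Normalized.

(** * Reduction to the normalized case *)

Lemma class_preserving_inner (f : gT -> gT) :
    {in G &, {morph f : g h / g * h}} -> {in G, forall g, f g \in g ^: G} ->
  exists2 g, g \in G & {in G, forall h, f h = h ^ g}.
Proof.
move=> fM f_class; have [/andP[sAG nAG] sQG defG nAQ tiAQ] := sdprod_context sdG.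
have Gx := subsetP sQG x Qx; have Gy := subsetP sQG y Qy.
have sXQ : <[x]> \subset Q by rewrite cycle_subG.
have conjM (h : gT -> gT) g : {in G &, {morph h : a b / a * b}} ->
    {in G &, {morph (fun a => h a ^ g) : a b / a * b}}.
  by move=> hM a b Ga Gb; rewrite hM // conjMg.
have conj_class (h : gT -> gT) g : g \in G -> {in G, forall a, h a \in a ^: G} ->
    {in G, forall a, h a ^ g \in a ^: G}.
  move=> Gg hcl a Ga; have /imsetP[k Gk ->] := hcl a Ga.
  by rewrite -conjgM memJ_class ?groupM.
have [h1 Gh1 fx] := imsetP (f_class x Gx).
have [h Gh fy] := imsetP (conj_class f h1^-1 (groupVr Gh1) f_class y Gy).
have [w [b [Qw Ab def_h]]] : exists w b, [/\ w \in Q, b \in A & h = w * b].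
  move: Gh; rewrite -defG -(normC nAQ) => /mulsgP[w b Qw Ab ->].
  by exists w, b.
(* Since [v] commutes with [x], undoing it corrects the image of [y] without moving [x]. *)
have [v Xv yw] : exists2 v, v \in <[x]> & y ^ w = y ^ v.
  have [Xw | Xw] := defQ w Qw; first by exists w.
  by exists (y^-1 * w) => //; rewrite -{1}(mulKVg y w) conjgM [y ^ y]conjgE mulKg.
have Qv := subsetP sXQ v Xv; have Gv := subsetP sQG v Qv.
pose f2 g := (f g ^ h1^-1) ^ v^-1.
have f2M : {in G &, {morph f2 : g h / g * h}} by exact: (conjM _ _ (conjM _ _ fM)).
have f2_class : {in G, forall g, f2 g \in g ^: G}.
  by apply: (conj_class); rewrite ?groupV //; apply: (conj_class); rewrite ?groupV.
have f2x : f2 x = x.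
  rewrite /f2 fx conjgK; apply/conjg_fixP/commgP/commuteV.
  by case/cycleP: Xv => i ->; apply/commuteX.
have Abv : b ^ v^-1 \in A by rewrite memJ_compl ?groupV.
have f2y : f2 y = y ^ (b ^ v^-1).
  by rewrite /f2 fy def_h conjgM yw -!conjgM [b ^ _]conjgE invgK mulgA.
have [a0 Aa0 ext] := eq_power_morphism _ _ abelA.
(* The factor of the conjugating element in [A] fixes [a0], which leaves one in [Q]. *)
have [r Qr f2a0] : exists2 r, r \in Q & f2 a0 = a0 ^ r.
  have /imsetP[g + ->] := f2_class a0 (subsetP sAG a0 Aa0).
  rewrite -defG => /mulsgP[a q Aa Qq ->]; exists q => //; rewrite conjgM.
  by congr (_ ^ q); apply/conjg_fixP/commgP/(centsP abelA).
have f2A : {in A, forall a, f2 a = a ^ r}.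
  apply: (ext f2 (fun a => a ^ r)) => //.
  - by move=> a a' Aa Aa'; rewrite f2M ?(subsetP sAG).
  - by move=> a a' _ _; rewrite conjMg.
  - move=> a Aa; have /imsetP[g + ->] := f2_class a (subsetP sAG a Aa).
    rewrite -defG => /mulsgP[a' q Aa' Qq ->]; rewrite conjgM.
    have /conjg_fixP-> : [~ a, a'] == 1 by apply/commgP/(centsP abelA).
    by have [k ->] := powA q Qq; rewrite ?expgz_cycle.
  by move=> a Aa; have [k ->] := powA r Qr; rewrite ?expgz_cycle.
have f2A1 : {in A, forall a, f2 a = a}.
  apply: (normalized_trivial_on_normal f2 f2M f2_class r [~ y, b ^ v^-1]) => //.
    by rewrite -invg_comm groupV compl_mem_comm.
  by rewrite f2y conjg_mulR.
have [g Gg f2g] := normalized_inner f2 f2M _ f2A1 f2x Abv f2y.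
exists (g * v * h1) => [|k Gk]; first by rewrite !groupM.
by rewrite !conjgM -f2g // /f2 !conjgKV.
Qed.

End ClassPreserving.

(** * The Sylow hypothesis and the conclusion *)

(* If O_2(A) were not inside B, then P = O_2(A) B would make P / O_2(A), hence
   Q, abelian. *)
Lemma index2_abelian_compl (gT : finGroupType) (G A Q P B : {group gT}) :
    A ><| Q = G -> ~~ abelian Q -> Q \subset P -> 2.-Sylow(G) P ->
    B \subset P -> #|P : B| = 2 -> abelian B ->
  'O_2(A) \subset B /\ #|Q : B :&: Q| = 2.
Proof.
move=> sdG nabQ sQP sylP sBP iB abB.
have [nAG sQG defG nAQ tiAQ] := sdprod_context sdG.
have nA2 : 'O_2(A) <| G := char_normal_trans (pcore_char 2 A) nAG.
have sA2P : 'O_2(A) \subset P.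
  apply: subset_trans (pcore_sub_Hall sylP).
  exact: pcore_max (pcore_pgroup 2 A) nA2.
have maxB : maximal B P by apply: p_index_maximal; rewrite // iB.
have nsBP : B <| P by apply: index2_normal.
split; last first.
  (* Being nonabelian, [Q] is not inside the maximal subgroup [B], so [B * Q = P] and the index of
     [B] carries over to [Q]. *)
  have nsQB : ~~ (Q \subset B) by apply: contra nabQ => /abelianS ->.
  rewrite setIC indexgI -indexMg.
  by rewrite (mulg_normal_maximal nsBP).
apply: contraR nabQ => nsA2B.
have defP : B * 'O_2(A) = P := mulg_normal_maximal nsBP maxB sA2P nsA2B.
apply/derG1P/trivgP; rewrite -tiAQ subsetI der_sub andbT.
apply: subset_trans (dergS 1 sQP) (subset_trans _ (pcore_sub 2 A)).
apply: der1_min; first exact: subset_trans (pHall_sub sylP) (normal_norm nA2).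
by rewrite -defP quotientMidr quotient_abelian.
Qed.

Theorem lemma2p8 (gT : finGroupType) (G A Q : {group gT})
    (sdG : A ><| Q = G)
    (abelA : abelian A)
    (genQ : exists2 n : nat, 2 < n & Q \isog 'Q_(2 ^ n))
    (powA : forall q : gT, q \in Q ->
       exists k : int, forall a : gT, a \in A -> a ^ q = expgz a k)
    (sylB : exists2 P : {group gT}, P \in 'Syl_2(G) &
       exists B : {group gT}, [/\ B \subset P, #|P : B| = 2 & abelian B]) :
  Outc G = 1.
Proof.
have [n n_gt2 isoQ] := genQ.
have [pQ nabQ _ centerQ squaresQ] := quaternion_invariants _ _ _ n_gt2 isoQ.
have [nAG sQG defG nAQ tiAQ] := sdprod_context sdG.
case: sylB => P0; rewrite inE => sylP0 [B0 [sBP0 iB0 abB0]].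
(* Replacing the Sylow subgroup by a conjugate lets it contain the 2-group [Q]. *)
have [g Gg sQP] := Sylow_subJ sylP0 sQG pQ.
have [||||sA2B iC] :=
  @index2_abelian_compl _ G A Q (P0 :^ g)%G (B0 :^ g)%G sdG nabQ sQP.
- by rewrite pHallJ.
- by rewrite conjSg.
- by rewrite /= indexJg.
- by rewrite abelianJ.
set B := (B0 :^ g)%G in sA2B iC.
have abB : abelian B by rewrite abelianJ.
set C := (B :&: Q)%G in iC.
have sCQ : C \subset Q by apply: subsetIr.
have /cyclicP[x defC] : cyclic C.
  apply: (abelian_sub_quaternion_cyclic _ _ _ _ n_gt2 isoQ sCQ).
  exact: abelianS (subsetIl _ _) abB.
have /andP[_ nCQ] : C <| Q by apply: index2_normal.
have [y Qy C'y] : exists2 y, y \in Q & y \notin C.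
  apply/subsetPn/negP => sQC; move: iC.
  by move/eqP; rewrite (eqP (_ : #|Q : C| == 1)%N) ?indexg_eq1.
have Cx : x \in C by rewrite defC cycle_id.
have Qx := subsetP sCQ x Cx.
apply/Outc_eq1 => s /setIdP[As /forall_inP s_class].
apply: (class_preserving_inner _ _ _ _ sdG abelA powA squaresQ
          x y Qx Qy _ _ centerQ _ s) => //.
- by rewrite -defC memJ_norm // (subsetP nCQ).
- move=> w Qw; rewrite -defC; have [Cw | C'w] := boolP (w \in C); first by left.
  right; have : w \in C :* y by rewrite (@rcoset_index2 _ Q) // inE ?C'w ?C'y.
  by case/rcosetP=> c Cc ->; rewrite -conjgE memJ_norm // (subsetP nCQ).
- move=> a Aa pa.
  (* The 2-elements of [A] lie in ['O_2(A)], hence in the abelian group [B], which also contains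
     [x]. *)
  have Ba : a \in B.
    apply: (subsetP sA2B); rewrite -cycle_subG pcore_max //.
    by rewrite -sub_abelian_normal ?cycle_subG.
  apply/conjg_fixP/commgP/(centsP abB) => //.
  by have /setIP[] := Cx.
by move=> a b Ga Gb; rewrite -!(autmE As) morphM.
Qed.
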